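(* Let $H\subsetneq\mathbb{N}$ be an Arf numerical semigroup written as $$H=\{h_0=0,h_1,\dots,h_n,\rightarrow\}=\{0,x_1,x_1+x_2,\dots,x_1+\dots+x_n,\rightarrow\}$$ with positive integers $x_1,\dots,x_n$ and $h_j=x_1+\dots+x_j$ for all $j\in\{1,\dots,n\}$. Then $\mathrm{F}(H)+2$ is in the minimal Arf system of generators of $H$ if and only if $x_j\ne x_{j+1}+\dots+x_n+1$ for all $j\in\{1,\dots,n\}$ (for $j=n$ the sum $x_{j+1}+\dots+x_n$ is empty, i.e. $0$).
   Context: $\mathbb{N}$ is the set of non-negative integers. A numerical semigroup is a subset $H\subseteq\mathbb{N}$ that contains $0$, is closed under addition, and has finite complement in $\mathbb{N}$. It is Arf if $2a-b\in H$ for all $a,b\in H$ with $a\ge b$. The Frobenius number $\mathrm{F}(H)$ is the largest element of $\mathbb{N}\setminus H$. The notation $H=\{h_0=0,h_1,\dots,h_n,\rightarrow\}$ means that $h_0<h_1<\dots<h_n$ are the elements of $H$ up to its conductor $h_n=\mathrm{F}(H)+1$, listed increasingly, and that every integer larger than $h_n$ is in $H$; thus $x_j=h_j-h_{j-1}$. (It is known that a set of this form, with $x_j$ positive integers, is an Arf numerical semigroup if and only if $x_j\in\{x_{j+1},x_{j+1}+x_{j+2},\dots,x_{j+1}+\dots+x_n,\rightarrow\}$ for all $j\in\{1,\dots,n\}$, where ''$\rightarrow$'' means that all larger integers are included.) For $X\subset\mathbb{N}$ with $\gcd(X)=1$, $\langle X\rangle$ is the submonoid of $\mathbb{N}$ generated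 by $X$ and $\mathrm{Arf}(\langle X\rangle)$ (the Arf closure) is the smallest Arf numerical semigroup, with respect to inclusion, containing $\langle X\rangle$. $X$ is an Arf system of generators of $H$ if $\mathrm{Arf}(\langle X\rangle)=H$, and it is minimal if no proper subset of $X$ is an Arf system of generators of $H$. It is known that every Arf numerical semigroup has a unique minimal Arf system of generators. *)

(* Defs.v *)
From mathcomp Require Import all_boot.
From mathcomp Require Import boolp classical_sets functions cardinality.

Set Implicit Arguments.
Unset Strict Implicit.
Unset Printing Implicit Defensive.

Local Open Scope classical_set_scope.

Definition submonoid (M : set nat) : Prop :=
  M 0 /\ (forall a b, M a -> M b -> M (a + b)).

Definition numerical_semigroup (H : set nat) : Prop :=
  submonoid H /\ finite_set (~` H).

(* The guard [b <= a] makes the truncated subtraction [2 * a - b] exact. *)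
Definition Arf_semigroup (H : set nat) : Prop :=
  numerical_semigroup H /\
  (forall a b, H a -> H b -> b <= a -> H (2 * a - b)).

Definition is_Frobenius_number (H : set nat) (F : nat) : Prop :=
  ~ H F /\ (forall m, ~ H m -> m <= F).

(* H = {h 0 = 0, h 1, ..., h n, ->}: the elements of H up to its conductor h n,
   listed increasingly, every larger integer being in H. *)
Definition written_as (H : set nat) (n : nat) (h : nat -> nat) : Prop :=
  [/\ h 0 = 0,
      forall j, j < n -> h j < h j.+1,
      H = [set m | (exists2 j, j <= n & m = h j) \/ h n < m]
    & exists2 F, is_Frobenius_number H F & h n = F + 1].

(* Divisibility formulation, since X may be infinite. *)
Definition is_gcd (X : set nat) (g : nat) : Prop :=
  (forall x, X x -> g %| x) /\
  (forall d, (forall x, X x -> d %| x) -> d %| g).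

Definition gen_submonoid (X : set nat) : set nat := smallest submonoid X.

(* [smallest] is an intersection; it is itself an Arf numerical semigroup as
   soon as M has finite complement, e.g. M = gen_submonoid X with gcd(X) = 1. *)
Definition Arf_closure (M : set nat) : set nat := smallest Arf_semigroup M.

Definition Arf_system_of_generators (H X : set nat) : Prop :=
  is_gcd X 1 /\ Arf_closure (gen_submonoid X) = H.

Definition minimal_Arf_system_of_generators (H X : set nat) : Prop :=
  Arf_system_of_generators H X /\
  (forall Y, Y `<` X -> ~ Arf_system_of_generators H Y).

(* Main.v *)
Require Import Defs.
From mathcomp Require Import all_boot.
From mathcomp Require Import boolp classical_sets functions cardinality.
From mathcomp Require Import zify.

Local Open Scope classical_set_scope.

(** Since [h n = F + 1], the equation [x j = x (j+1) + ... + x n + 1] says that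
    [2 h_j - h_(j-1) = F + 2].  If it holds for some [j] and [K] is an Arf
    semigroup containing [X] minus [F + 2], then [K] together with all integers
    [>= F + 2] is an Arf semigroup containing [X], hence [H]; so [K] contains
    [h_(j-1)] and [h_j], hence [F + 2], and [F + 2] is redundant in [X].

    If [F + 2] is not in [X], then [H] minus [F + 2] cannot be an Arf semigroup,
    so [F + 2 = u + v - b] with [u, v, b] in [H] and [b < u, v].  Let [e] be the
    successor of [b] in [H].  Either [u = v = e], and [b, e] are consecutive as
    wanted, or, say, [e < u]; then [F + 2 = u + (v + e - b) - e], where
    [v + e - b] is in [H] and [b] has been replaced by the larger [e]. *)

Lemma Arf_closure_genP (X : set nat) (m : nat) :
  Arf_closure (gen_submonoid X) m <->
  (forall K, Arf_semigroup K -> X `<=` K -> K m).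
Proof.
split=> [clm K ArfK XK|allm K [ArfK genK]].
  by apply: clm; split=> // y; apply; split=> //; case: ArfK => -[].
apply: allm => // y Xy; apply: genK => M [_]; exact.
Qed.

(** For [b < u <= v], the triple [u], [2 * u - b], [v] has the same value [u + v - b] but a larger
    base, so induction on the value minus the base ends at [b = u]. *)
Lemma Arf_addB (H : set nat) : Arf_semigroup H ->
  forall b u v, H b -> H u -> H v -> b <= u -> b <= v -> H (u + v - b).
Proof.
move=> [_ H2B] b u v; have [k] := ubnP (u + v - b - b).
elim: k => // k IHk in b u v *.
wlog uv : u v / u <= v => [hwlog|] ltk Hb Hu Hv bu bv.
  by have [uv|/ltnW vu] := leqP u v; [|rewrite addnC]; apply: hwlog => //; lia.
have [<-|nbu] := eqVneq b u; first by rewrite addKn.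
have -> : u + v - b = (2 * u - b) + v - u by lia.
by apply: IHk => //; [lia|exact: H2B|lia].
Qed.

(** [K] may have infinite complement, so this also covers the multiples of an integer. *)
Lemma Arf_setU_ge (K : set nat) (N : nat) :
  submonoid K -> (forall a b, K a -> K b -> b <= a -> K (2 * a - b)) ->
  Arf_semigroup (K `|` [set m | N <= m]).
Proof.
move=> [K0 KD] K2B; split; [split; [split|]|].
- by left.
- move=> a b [Ka|/= Na] [Kb|/= Nb]; [by left; exact: KD|right=> /=; lia..].
- apply: sub_finite_set (finite_II N) => m /= nKm.
  by rewrite ltnNge; apply/negP => Nm; apply: nKm; right.
- move=> a b Ka Kb ba; have [Na|aN] := leqP N a; first by right=> /=; lia.
  case: Ka => [Ka|/=]; last by lia.
  by case: Kb => [Kb|/=]; [left; exact: K2B|lia].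
Qed.

(** Both ways of producing [m] have the excluded form: a sum of positive elements is the case
    [b = 0], and [2 * a - b] the case [u = v]. *)
Lemma Arf_setD1 (H : set nat) (m : nat) : Arf_semigroup H -> 0 < m ->
  (forall b u v, H b -> H u -> H v -> b < u -> b < v -> u + v - b <> m) ->
  Arf_semigroup (H `\ m).
Proof.
move=> [[[H0 HD] Hfin] H2B] m0 nm; split; [split; [split|]|].
- by split=> //= e; rewrite -e in m0.
- move=> a b [Ha am] [Hb bm]; split; first exact: HD.
  move=> /= abm; have [a0|a0] := posnP a; first by apply: bm => /=; lia.
  have [b0|b0] := posnP b; first by apply: am => /=; lia.
  by apply: (nm 0 a b) => //; lia.
- by rewrite setCD finite_setU; split=> //; exact: finite_set1.
- move=> a b [Ha am] [Hb bm] ba; split; first exact: H2B.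
  move=> /= abm; have [e|nba] := eqVneq b a; first by apply: am => /=; lia.
  by apply: (nm b a a) => //; lia.
Qed.

Lemma Frobenius_number_uniq (H : set nat) (F F' : nat) :
  is_Frobenius_number H F -> is_Frobenius_number H F' -> F = F'.
Proof.
move=> [nF Fmax] [nF' F'max]; apply/eqP.
by rewrite eqn_leq F'max ?Fmax.
Qed.

Lemma Frobenius_number_lt (H : set nat) (F m : nat) :
  is_Frobenius_number H F -> F < m -> H m.
Proof. by move=> [_ Fmax] Fm; apply: contrapT => /Fmax; lia. Qed.

Lemma written_as_succ (H : set nat) (n : nat) (h : nat -> nat) (b : nat) :
  written_as H n h -> H b -> b < h n ->
  exists i, [/\ i < n, b = h i & forall u, H u -> b < u -> h i.+1 <= u].
Proof.
move=> [_ hlt HE _].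
have hmono j k : j <= k -> k <= n -> h j <= h k.
  elim: k => [|k IHk] jk kn; first by have -> : j = 0 by lia.
  have [->//|njk] := eqVneq j k.+1.
  by apply: leq_trans (IHk _ _) (ltnW (hlt _ _)); lia.
rewrite HE => -[[i i_n ->] hin|/=]; last by lia.
have lt_in : i < n by have [//|ni|e] := ltngtP i n; [lia|rewrite e ltnn in hin].
exists i; split=> // u [[k kn ->] hik|/= hnu _].
  have [ik|ki] := ltnP i k; first exact: hmono.
  by have := hmono _ _ ki i_n; lia.
by apply: leq_trans (hmono _ _ lt_in _) (ltnW hnu).
Qed.

Lemma Arf_addB_consecutive (H : set nat) (n : nat) (h : nat -> nat) (m : nat) :
  Arf_semigroup H -> written_as H n h -> m <= (h n).+1 ->
  forall b u v, H b -> H u -> H v -> b < u -> b < v -> u + v - b = m ->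
  exists2 j, 1 <= j <= n & 2 * h j = h j.-1 + m.
Proof.
move=> ArfH Hw mn b u v; have [k] := ubnP (m - b).
elim: k => // k IHk in b u v *.
wlog uv : u v / u <= v => [hwlog|] ltk Hb Hu Hv bu bv uvm.
  by have [uv|/ltnW vu] := leqP u v; [apply: (hwlog u v)|apply: (hwlog v u)] => //; lia.
(* Since [u] and [v] exceed [b], [m >= b + 2]; the bound on [m] thus puts [b] below the
   conductor. *)
have bn : b < h n by lia.
have [i [lt_in bE bnext]] := written_as_succ _ _ _ _ Hw Hb bn.
have hu : h i.+1 <= u by exact: bnext.
have hb : b < h i.+1 by case: Hw => _ hlt _ _; rewrite bE; exact: hlt.
have Hi : H (h i.+1) by case: Hw => _ _ -> _; left; exists i.+1.
(* As [h i.+1 <= u <= v], equality with [v] forces [u = v = h i.+1]. *)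
have [e|ne] := eqVneq (h i.+1) v; first by exists i.+1 => //=; lia.
apply: (IHk (h i.+1) (u + h i.+1 - b) v) => //; try lia.
by apply: Arf_addB => //; lia.
Qed.

(** If [X] missed [m], it would lie in the Arf semigroup [H] minus [m], and so would its closure
    [H]. *)
Lemma minimal_Arf_generator_of_setD1 (H X : set nat) (m : nat) :
  Arf_system_of_generators H X -> H m -> Arf_semigroup (H `\ m) -> X m.
Proof.
move=> [_ XH] Hm ArfD; apply: contrapT => nXm.
have : (H `\ m) m; last by case=> _; apply.
have /Arf_closure_genP : Arf_closure (gen_submonoid X) m by rewrite XH.
apply=> // y Xy; split; last by move=> /= e; apply: nXm; rewrite -e.
by rewrite -XH; apply/Arf_closure_genP => K _; apply.
Qed.

Lemma Arf_system_of_generators_setD1 (H X : set nat) (a b F : nat) :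
  Arf_semigroup H -> is_Frobenius_number H F -> Arf_system_of_generators H X ->
  H a -> H b -> b <= a -> a < F + 2 -> 2 * a - b = F + 2 ->
  Arf_system_of_generators H (X `\ (F + 2)).
Proof.
move=> ArfH HF [_ XH] Ha Hb ba aF abF.
have XsubH : X `<=` H.
  by move=> y Xy; rewrite -XH; apply/Arf_closure_genP => K _; apply.
have genX K m : Arf_semigroup K -> X `<=` K -> H m -> K m.
  by rewrite -XH => ArfK XK /Arf_closure_genP; apply.
have HsubK K : Arf_semigroup K -> X `\ (F + 2) `<=` K -> H `<=` K.
  move=> [[Kmon Kfin] K2B] XK.
  have low m : H m -> m < F + 2 -> K m.
    move=> Hm mF.
    (* The added tail absorbs the generator [F + 2] without changing [K] below it. *)
    have : (K `|` [set m | F + 2 <= m]) m; last by case=> //=; lia.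
    apply: genX => //; first exact: Arf_setU_ge.
    move=> y Xy; have [->|ny] := eqVneq y (F + 2); first by right=> /=.
    by left; apply: XK; split=> //=; exact/eqP.
  move=> m; apply: genX; first by split.
  move=> y Xy; have [->|ny] := eqVneq y (F + 2).
    by rewrite -abF; apply: K2B => //; apply: low => //; lia.
  by apply: XK; split=> //=; exact/eqP.
split.
  split=> [y _|d dX]; first exact: dvd1n.
  (* The multiples of [d], truncated above [F + 2], form an Arf semigroup
     containing [H], so [d] divides both [F + 1] and [F + 2]. *)
  have dH m : H m -> m < F + 3 -> d %| m.
    move=> Hm mF.
    have : ([set m | d %| m] `|` [set m | F + 3 <= m]) m; last by case=> //=; lia.
    apply: HsubK Hm => [|y /dX]; last by left.
    apply: Arf_setU_ge; first by split=> [|p q]; [exact: dvdn0|exact: dvdn_add].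
    by move=> p q /= dp dq qp; rewrite dvdn_sub// dvdn_mull.
  have d1 : d %| F + 1 by apply: dH; [apply: (Frobenius_number_lt _ _ _ HF)|]; lia.
  have d2 : d %| F + 2 by apply: dH; [apply: (Frobenius_number_lt _ _ _ HF)|]; lia.
  have -> : 1 = (F + 2) - (F + 1) by lia.
  exact: dvdn_sub.
apply/seteqP; split=> m.
  by move=> /Arf_closure_genP clm; apply: (clm H) => // y [/XsubH].
by move=> Hm; apply/Arf_closure_genP => K ArfK /HsubK; apply.
Qed.

(** The tail sum is [h n - h j] and [x j] is [h j - h j.-1]; here [m] is the Frobenius number. *)
Lemma partial_sum_gap (n j m : nat) (h x : nat -> nat) :
  h 0 = 0 -> (forall j, 1 <= j <= n -> h j = \sum_(1 <= i < j.+1) x i) ->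
  1 <= j <= n -> h n = m + 1 ->
  (x j = \sum_(j.+1 <= i < n.+1) x i + 1 <-> 2 * h j = h j.-1 + (m + 2)).
Proof.
move=> h0 hE jn hn.
have hj : h j = h j.-1 + x j.
  rewrite hE// big_nat_recr/=; last by lia.
  case: j jn => // -[|j] jn /=; first by rewrite h0 big_geq.
  by rewrite hE//; lia.
have hnj : h n = h j + \sum_(j.+1 <= i < n.+1) x i.
  by rewrite (hE n) ?(hE j) ?(@big_cat_nat _ _ _ j.+1 1 n.+1)//; lia.
split; lia.
Qed.

Theorem theorem4p4 (H : set nat) (n : nat) (h x : nat -> nat) (F : nat)
    (X : set nat)
    (H_Arf : Arf_semigroup H)
    (H_proper : H `<` [set: nat])
    (H_written : written_as H n h)
    (x_pos : forall j, 1 <= j <= n -> 0 < x j)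
    (h_sum : forall j, 1 <= j <= n -> h j = \sum_(1 <= i < j.+1) x i)
    (F_Frobenius : is_Frobenius_number H F)
    (X_minimal : minimal_Arf_system_of_generators H X) :
  X (F + 2) <->
  (forall j, 1 <= j <= n -> x j <> \sum_(j.+1 <= i < n.+1) x i + 1).
Proof.
have [h0 hlt HE [F' HF' hn']] := H_written.
have hn : h n = F + 1.
  by rewrite hn' (Frobenius_number_uniq _ _ _ HF' F_Frobenius).
have gapP j jn := partial_sum_gap n j F h x h0 h_sum jn hn.
have [Xgen Xmin] := X_minimal.
have Hh j : j <= n -> H (h j) by move=> jn; rewrite HE; left; exists j.
split=> [XF j jn /(gapP j jn) gap|no_gap].
  (* Together with [gap], this also yields [h j < F + 2]. *)
  have hj1 : h j.-1 < h j by have := hlt j.-1; rewrite prednK; lia.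
  apply: (Xmin (X `\ (F + 2))).
    by split=> [y []|/(_ _ XF)[_]]//; apply.
  apply: (@Arf_system_of_generators_setD1 H X (h j) (h j.-1)) => //; try lia;
    by apply: Hh; lia.
apply: (minimal_Arf_generator_of_setD1 H) => //.
  by apply: (Frobenius_number_lt _ _ _ F_Frobenius); lia.
apply: Arf_setD1 => // [|b u v Hb Hu Hv bu bv uvF]; first by lia.
have [|j jn] := Arf_addB_consecutive _ _ _ (F + 2) H_Arf H_written _ b u v Hb Hu Hv bu bv uvF.
  by lia.
by move=> /(gapP j jn); exact: no_gap.
Qed.
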